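(* Let $A$ be a $t$-locally P$v$MD (i.e. an integral domain such that $A_{\mathfrak m}$ is a P$v$MD for every $\mathfrak m\in t\text{-}\mathrm{Max}(A)$). The following are equivalent: (i) Each $t$-locally $t$-invertible $t$-ideal of $A$ is $t$-invertible. (ii) $A$ has the $t$-finite character. (iii) $A$ is a P$v$MD with the $t$-finite character.
   Context: Let $A$ be an integral domain with quotient field $K$. ''Ideal'' means integral ideal. For a nonzero fractional ideal $I$, $I^{-1}=(A:I)=\{x\in K: xI\subseteq A\}$, $I^v=(I^{-1})^{-1}$, and $I^t=\bigcup\{J^v: J\subseteq I,\ J \text{ nonzero finitely generated}\}$. $I$ is a $t$-ideal if $I^t=I$ ($t$-ideals are nonzero by definition), and $I$ is $t$-invertible if $(II^{-1})^t=A$. $t\text{-}\mathrm{Max}(A)$ is the set of $t$-maximal ideals, i.e. the maximal elements of the set of proper (nonzero, integral) $t$-ideals; they are prime. $A$ has the $t$-finite character if each nonzero element of $A$ is contained in only finitely many $t$-maximal ideals. A P$v$MD (Prüfer $v$-multiplication domain) is a domain in which every nonzero finitely generated ideal is $t$-invertible. An ideal $I$ is $t$-locally $t$-invertible if for every $\mathfrak m\in t\text{-}\mathrm{Max}(A)$ the ideal $IA_{\mathfrak m}$ is $t$-invertible in $A_{\mathfrak m}$ (with respect to the $t$-operation of $A_{\mathfrak m}$). *)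

(* Defs.v *)
From mathcomp Require Import all_boot all_order all_algebra all_classical.

Set Implicit Arguments.
Unset Strict Implicit.
Unset Printing Implicit Defensive.

Import GRing.Theory.
Local Open Scope classical_set_scope.
Local Open Scope ring_scope.

(* A domain is represented by its image in a fixed quotient field K, so that
   the domain, its localizations and all their fractional ideals are subsets
   of K. The definitions below are meant for subrings D of K with Frac D = K:
   they are used for D = A and for the localizations D = A_m. *)

Definition dom (A : idomainType) : set {fraction A} :=
  range (@FracField.tofrac A).
Arguments dom A _ : clear implicits.

Section IdealsInQuotientField.
Variables (K : fieldType) (D : set K).

Definition submodule (I : set K) : Prop :=
  [/\ I 0,
      forall x y, I x -> I y -> I (x + y)
    & forall a x, D a -> I x -> I (a * x)].

Definition ideal (I : set K) : Prop := submodule I /\ I `<=` D.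

Definition nonzero (I : set K) : Prop := exists2 x, I x & x != 0.

Definition span (s : seq K) : set K :=
  [set x | exists2 c : 'I_(size s) -> K,
     forall i, D (c i) & x = \sum_(i < size s) c i * s`_i].

Definition finitely_generated (I : set K) : Prop :=
  exists s : seq K, I = span s.

Definition prod_ideal (I J : set K) : set K :=
  [set x | exists2 s : seq (K * K),
     forall p, p \in s -> I p.1 /\ J p.2 & x = \sum_(p <- s) p.1 * p.2].

Definition inv_ideal (I : set K) : set K :=
  [set x | forall y, I y -> D (x * y)].

Definition v_closure (I : set K) : set K := inv_ideal (inv_ideal I).

Definition t_closure (I : set K) : set K :=
  \bigcup_(J in [set J | [/\ J `<=` I, nonzero J & finitely_generated J]])
    v_closure J.

Definition t_ideal (I : set K) : Prop :=
  [/\ ideal I, nonzero I & t_closure I = I].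

Definition t_invertible (I : set K) : Prop :=
  t_closure (prod_ideal I (inv_ideal I)) = D.

Definition proper_t_ideal (I : set K) : Prop := t_ideal I /\ I <> D.

Definition t_maximal (m : set K) : Prop :=
  proper_t_ideal m /\
  forall I, proper_t_ideal I -> m `<=` I -> I = m.

Definition t_finite_character : Prop :=
  forall x, D x -> x != 0 -> finite_set [set m | t_maximal m /\ m x].

Definition PvMD : Prop :=
  forall I, ideal I -> nonzero I -> finitely_generated I -> t_invertible I.

Definition localization (m : set K) : set K :=
  [set x | exists a s, [/\ D a, D s, ~ m s & x = a / s]].

Definition extension (m I : set K) : set K := prod_ideal I (localization m).

End IdealsInQuotientField.

Definition t_locally_t_invertible (K : fieldType) (D I : set K) : Prop :=
  forall m, t_maximal D m -> t_invertible (localization D m) (extension D m I).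

Definition t_locally_PvMD (K : fieldType) (D : set K) : Prop :=
  forall m, t_maximal D m -> PvMD (localization D m).

(* Main.v *)
(* Write V(s) for the set of t-maximal ideals containing a finite list s.

   (ii) => (iii): if the t-finite character holds and m is t-maximal, a finite
   subset of m can be enlarged within m until V of it is {m}. Hence the maximal
   ideal of A_m is a t-ideal, so t-invertibility in A_m yields a product not in
   that ideal; clearing denominators, I I^-1 is contained in no m when I is
   finitely generated.

   (iii) => (i): by the same argument I is generated at each m by one element of
   I. An element x of I, together with generators at the finitely many m
   containing x, spans a J with J^-1 = I^-1, and J is t-invertible.

   (i) => (ii): applying (i) to I^t for I finitely generated shows that A is a
   PvMD. If x lies in infinitely many t-maximal ideals, there are lists e_i
   containing x with V(e_i) nonempty and pairwise disjoint: either infinitely many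
   m are isolated, i.e. of the form V(s) = {m}, or some list avoids the isolated
   ones and can be split again and again. Then the union over n of
   x (e_0 ... e_(n-1))^-1 is a t-ideal which is locally principal, because V(e_i)
   meets each {m} for at most one i, but which is not t-invertible, because the
   step from n to n + 1 is strict at every ideal in V(e_n). *)
Require Import Defs.
From mathcomp Require Import all_boot all_order all_algebra all_classical.

Set Implicit Arguments.
Unset Strict Implicit.
Unset Printing Implicit Defensive.

Import GRing.Theory.
Local Open Scope classical_set_scope.
Local Open Scope ring_scope.

(* [span] is also exported by mathcomp's vector. *)
Local Notation span := Defs.span.

Definition subsemiring (K : fieldType) (D : set K) : Prop :=
  submodule D D /\ D 1.

(* The v-closure of the D-module generated by the list s. *)
Definition vlist (K : fieldType) (D : set K) (s : seq K) : set K :=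
  [set z | forall x, (forall y, y \in s -> D (x * y)) -> D (x * z)].

Lemma set_cons_sub (T : eqType) (x : T) (s : seq T) (P : set T) :
  [set` x :: s] `<=` P <-> P x /\ [set` s] `<=` P.
Proof.
split=> [h|[Px sP] y /=].
  split=> [|y ys]; first by apply: h; rewrite /= mem_head.
  by apply: h; rewrite /= in_cons ys orbT.
by rewrite in_cons => /predU1P[->|/sP].
Qed.

Lemma set_cat_sub (T : eqType) (s1 s2 : seq T) (P : set T) :
  [set` s1 ++ s2] `<=` P <-> [set` s1] `<=` P /\ [set` s2] `<=` P.
Proof.
split=> [h|[h1 h2] y /=].
  by split=> y ys; apply: h; rewrite /= mem_cat ys ?orbT.
by rewrite mem_cat => /orP[/h1|/h2].
Qed.

Lemma set_map_sub (S T : eqType) (f : S -> T) (s : seq S) (P : set T) :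
  [set` map f s] `<=` P <-> (forall y, y \in s -> P (f y)).
Proof.
split=> [h y ys|h y /= /mapP[z zs ->]]; last exact: h.
by apply: h; rewrite /= map_f.
Qed.

(** * The t-operation in terms of finite lists *)

Section Closure.
Variables (K : fieldType) (D : set K).
Hypothesis Dring : subsemiring D.

Let DM x y : D x -> D y -> D (x * y).
Proof. by have [[_ _ h] _] := Dring; exact: h. Qed.

Lemma submodule_sum (I : set K) (T : Type) (s : seq T) (P : pred T) (F : T -> K) :
  submodule D I -> (forall i, P i -> I (F i)) -> I (\sum_(i <- s | P i) F i).
Proof.
by move=> [I0 ID _] h; elim/big_ind: _.
Qed.

Lemma preim_mul_submodule (I : set K) x :
  submodule D I -> submodule D [set y | I (x * y)].
Proof.
move=> [I0 ID IM]; split=> [|y z|a y Da] /=; first by rewrite mulr0.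
  by rewrite mulrDr; exact: ID.
by rewrite mulrCA; exact: IM.
Qed.

Lemma span_sub (s : seq K) (I : set K) :
  submodule D I -> [set` s] `<=` I -> span D s `<=` I.
Proof.
move=> Imod sI _ [c Dc ->]; apply: submodule_sum => // i _.
by have [_ _ IM] := Imod; apply: IM => //; apply: sI; exact: mem_nth.
Qed.

Lemma span_mem (s : seq K) : [set` s] `<=` span D s.
Proof.
move=> x /= xs; have xi : (index x s < size s)%N by rewrite index_mem.
exists (fun i => if i == Ordinal xi then 1 else 0).
  by move=> i; case: ifP => // _; have [[]] := Dring.
rewrite (bigD1 (Ordinal xi)) //= eqxx mul1r nth_index // big1 ?addr0 //.
by move=> i /negPf ->; rewrite mul0r.
Qed.

Lemma span_submodule (s : seq K) : submodule D (span D s).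
Proof.
have [[D0 DD _] _] := Dring; split.
- by exists (fun=> 0) => //; rewrite big1 // => i _; rewrite mul0r.
- move=> _ _ [c Dc ->] [d Dd ->]; exists (fun i => c i + d i).
    by move=> i; exact: DD.
  by rewrite -big_split; apply: eq_bigr => i _; rewrite mulrDl.
- move=> a _ Da [c Dc ->]; exists (fun i => a * c i) => [i|]; first exact: DM.
  by rewrite mulr_sumr; apply: eq_bigr => i _; rewrite mulrA.
Qed.

Lemma inv_span (s : seq K) x :
  inv_ideal D (span D s) x <-> forall y, y \in s -> D (x * y).
Proof.
split=> [h y ys|h]; first by apply: h; exact: span_mem.
apply: (span_sub _ h); apply: preim_mul_submodule.
by have [] := Dring.
Qed.

(** Multiplying a span into [D] is tested on generators, so finitely generated ideals can be handled
    as lists. *)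
Lemma v_closure_span (s : seq K) : v_closure D (span D s) = vlist D s.
Proof.
apply/seteqP; split=> z h x => [/inv_span/h|/inv_span]; first by rewrite mulrC.
by rewrite mulrC; exact: h.
Qed.

Lemma vlist_mem (s : seq K) : [set` s] `<=` vlist D s.
Proof. by move=> y ys x; exact. Qed.

Lemma vlist_trans (s s' : seq K) :
  [set` s'] `<=` vlist D s -> vlist D s' `<=` vlist D s.
Proof. by move=> s's z zs' x xs; apply: zs' => y /s's; exact. Qed.

Lemma vlist_sub (s s' : seq K) : [set` s'] `<=` [set` s] -> vlist D s' `<=` vlist D s.
Proof. by move=> s's; apply: vlist_trans => y /s's/vlist_mem. Qed.

Lemma vlist_submodule (s : seq K) : submodule D (vlist D s).
Proof.
have [[D0 DD _] _] := Dring; split=> [x _|y z hy hz x xs|a y Da hy x xs].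
- by rewrite mulr0.
- by rewrite mulrDr; apply: DD; [exact: hy|exact: hz].
- by rewrite mulrCA; apply: DM => //; exact: hy.
Qed.

Lemma vlist_integral (s : seq K) : [set` s] `<=` D -> vlist D s `<=` D.
Proof.
by move=> sD z hz; rewrite -[z]mul1r; apply: hz => y /sD; rewrite mul1r.
Qed.

Lemma vlist_scale (s : seq K) w z :
  vlist D s z -> vlist D (map ( *%R w) s) (w * z).
Proof.
move=> hz x h; rewrite mulrA; apply: hz => y ys; rewrite -mulrA.
by apply: h; exact: map_f.
Qed.

Lemma t_closureP (I : set K) z : submodule D I -> nonzero I ->
  (t_closure D I z <-> exists2 s, [set` s] `<=` I & vlist D s z).
Proof.
move=> Imod [x Ix x0]; split=> [[J [JI _ [s Js]] +]|[s sI sz]].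
  rewrite Js v_closure_span => sz; exists s => //.
  by rewrite Js in JI; apply: subset_trans JI; exact: span_mem.
(* The definition of [t_closure] wants a nonzero ideal, so a nonzero element of [I] is put in
   front. *)
have xsI : [set` x :: s] `<=` I by apply/set_cons_sub.
exists (span D (x :: s)); last first.
  rewrite v_closure_span; apply: vlist_sub sz => y /= ys.
  by rewrite in_cons ys orbT.
split; [exact: span_sub| |by exists (x :: s)].
by exists x => //; apply: span_mem; rewrite /= mem_head.
Qed.

(** Concatenating the lists found for the entries of [s'] suffices; this makes the t-closure
    idempotent. *)
Lemma vlist_merge (I : set K) (s' : seq K) :
  (forall z, z \in s' -> exists2 s, [set` s] `<=` I & vlist D s z) ->
  exists2 s, [set` s] `<=` I & [set` s'] `<=` vlist D s.
Proof.
elim: s' => [_|y s' IH h]; first by exists [::].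
have [|s1 s1I s1y] := h y; first by rewrite mem_head.
have [|s2 s2I s2s'] := IH.
  by move=> z zs'; apply: h; rewrite in_cons zs' orbT.
exists (s1 ++ s2); first by apply/set_cat_sub.
apply/set_cons_sub; split.
  by apply: vlist_sub s1y => z /= zs; rewrite mem_cat zs.
by move=> z /s2s'; apply: vlist_sub => w /= ws; rewrite mem_cat ws orbT.
Qed.

Lemma t_idealP (I : set K) : t_ideal D I <->
  [/\ ideal D I, nonzero I & forall s, [set` s] `<=` I -> vlist D s `<=` I].
Proof.
split=> -[Iid I0 h]; split=> //.
  move=> s sI z sz; rewrite -h; apply/t_closureP => //; first by case: Iid.
  by exists s.
have [Imod _] := Iid; apply/seteqP; split=> [z|z Iz].
  by move=> /(t_closureP _ Imod I0)[s sI sz]; exact: h sz.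
apply/t_closureP => //; exists [:: z]; first exact/set_cons_sub.
by apply: vlist_mem; rewrite /= mem_head.
Qed.

Lemma sub_t_closure (I : set K) : submodule D I -> nonzero I ->
  I `<=` t_closure D I.
Proof.
move=> Imod I0 z Iz; apply/t_closureP => //.
exists [:: z]; first exact/set_cons_sub.
by apply: vlist_mem; rewrite /= mem_head.
Qed.

Lemma t_closure_t_ideal (I : set K) :
  ideal D I -> nonzero I -> t_ideal D (t_closure D I).
Proof.
move=> [Imod ID] I0; apply/t_idealP; split.
- split; last first.
    move=> z /(t_closureP _ Imod I0)[s sI].
    by apply: vlist_integral; exact: subset_trans sI ID.
  split.
  + by apply: sub_t_closure => //; have [] := Imod.
  + move=> y z /(t_closureP _ Imod I0)[s sI sy] /(t_closureP _ Imod I0)[s' s'I s'z].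
    apply/t_closureP => //; exists (s ++ s'); first exact/set_cat_sub.
    have [_ + _] := vlist_submodule (s ++ s'); apply.
      by apply: vlist_sub sy => w /= ws; rewrite mem_cat ws.
    by apply: vlist_sub s'z => w /= ws; rewrite mem_cat ws orbT.
  + move=> a y Da /(t_closureP _ Imod I0)[s sI sy].
    apply/t_closureP => //; exists s => //.
    by have [_ _ +] := vlist_submodule s; apply.
- by have [x Ix x0] := I0; exists x => //; exact: sub_t_closure.
- move=> s' s'I z s'z; apply/t_closureP => //.
  have [y /s'I/t_closureP|s sI s's] := @vlist_merge I s'; first exact.
  by exists s => //; exact: vlist_trans s'z.
Qed.

Lemma ideal1 (I : set K) : ideal D I -> I 1 -> I = D.
Proof.
move=> [[_ _ IM] ID] I1; apply/seteqP; split=> // x Dx.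
by rewrite -[x]mulr1; exact: IM.
Qed.

Lemma prod_ideal_sub (I J P : set K) : P 0 ->
    (forall x y, P x -> P y -> P (x + y)) ->
    (forall x y, I x -> J y -> P (x * y)) ->
  prod_ideal I J `<=` P.
Proof.
move=> P0 PD PM _ [s sIJ ->]; rewrite big_seq.
by elim/big_ind: _ => // p /sIJ[]; exact: PM.
Qed.

Lemma prod_ideal_mul (I J : set K) x y : I x -> J y -> prod_ideal I J (x * y).
Proof.
move=> Ix Jy; exists [:: (x, y)]; last by rewrite big_seq1.
by move=> p; rewrite inE => /eqP ->.
Qed.

Lemma prod_ideal_submodule (I J : set K) :
  submodule D I -> submodule D (prod_ideal I J).
Proof.
move=> [I0 ID IM]; split.
- by exists [::]; rewrite ?big_nil.
- move=> _ _ [s sIJ ->] [s' s'IJ ->]; exists (s ++ s'); last by rewrite big_cat.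
  by move=> p; rewrite mem_cat => /orP[/sIJ|/s'IJ].
- move=> a _ Da [s sIJ ->]; exists [seq (a * p.1, p.2) | p <- s].
    by move=> _ /mapP[p /sIJ[Ip Jp] ->]; split=> //; exact: IM.
  by rewrite big_map mulr_sumr; apply: eq_bigr => p _; rewrite mulrA.
Qed.

Lemma prod_ideal_submoduler (I J : set K) :
  submodule D J -> submodule D (prod_ideal I J).
Proof.
move=> [J0 JD JM]; split.
- by exists [::]; rewrite ?big_nil.
- move=> _ _ [s sIJ ->] [s' s'IJ ->]; exists (s ++ s'); last by rewrite big_cat.
  by move=> p; rewrite mem_cat => /orP[/sIJ|/s'IJ].
- move=> a _ Da [s sIJ ->]; exists [seq (p.1, a * p.2) | p <- s].
    by move=> _ /mapP[p /sIJ[Ip Jp] ->]; split=> //; exact: JM.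
  by rewrite big_map mulr_sumr; apply: eq_bigr => p _; rewrite mulrCA.
Qed.

Lemma prod_inv_integral (I : set K) : prod_ideal I (inv_ideal D I) `<=` D.
Proof.
have [[D0 DD _] _] := Dring; apply: prod_ideal_sub => // x y Ix; rewrite mulrC.
exact.
Qed.

Lemma prod_inv_ideal (I : set K) :
  ideal D I -> ideal D (prod_ideal I (inv_ideal D I)).
Proof.
by move=> [Imod _]; split; [exact: prod_ideal_submodule|exact: prod_inv_integral].
Qed.

Lemma prod_inv_nonzero (I : set K) :
  ideal D I -> nonzero I -> nonzero (prod_ideal I (inv_ideal D I)).
Proof.
move=> [_ ID] [x Ix x0]; exists x => //; rewrite -[x]mulr1.
by apply: prod_ideal_mul => // y /ID; rewrite mul1r.
Qed.

Lemma t_invertibleP (I : set K) : ideal D I -> nonzero I ->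
  (t_invertible D I <->
   exists2 s, [set` s] `<=` prod_ideal I (inv_ideal D I) & vlist D s 1).
Proof.
move=> Iid I0; have Pid := prod_inv_ideal Iid.
have P0 := prod_inv_nonzero Iid I0; have [Pmod PD] := Pid.
have [Tid _ _] := t_closure_t_ideal Pid P0.
split=> [tI|[s sP s1]].
  by apply/t_closureP => //; rewrite tI; have [] := Dring.
by apply: ideal1 Tid _; apply/t_closureP => //; exists s.
Qed.

(** Zorn's lemma applies because the t-closure is finitary: a finite list in the union of a chain
    already lies in one member. *)
Lemma t_max_above (I : set K) : proper_t_ideal D I ->
  exists2 m, t_maximal D m & I `<=` m.
Proof.
move=> Ip.
(* Adjoining [I] throughout makes [I] itself the bound of the empty chain. *)
pose P X := proper_t_ideal D (X `|` I).
have [F FP Ftot|A [PA Amax]] := @Zorn_bigcup K P; last first.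
  exists (A `|` I); last by move=> x; right.
  split=> // J Jp AJ; have JI : J `|` I = J by apply/setUidPl => x Ix; apply: AJ; right.
  have [AJ'|nAJ] := pselect (J `<=` A).
    by apply/seteqP; split=> // x /AJ'; left.
  have /Amax : A `<` J by split=> // x Ax; apply: AJ; left.
  by rewrite /P JI.
have listP (s : seq K) : [set` s] `<=` \bigcup_(X in F) X `|` I ->
    exists Y, [/\ proper_t_ideal D Y, Y `<=` \bigcup_(X in F) X `|` I,
      I `<=` Y, [set` s] `<=` Y & Y = I \/ exists2 X, F X & Y = X `|` I].
  elim: s => [_|x s IH /set_cons_sub[Ux /IH[Y [Yp YU IY sY YF]]]].
    by exists I; split=> //; left.
  case: Ux => [[X FX Xx]|Ix]; last first.
    by exists Y; split=> //; apply/set_cons_sub; split=> //; exact: IY.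
  have XU : X `|` I `<=` \bigcup_(X in F) X `|` I.
    by move=> y [Xy|]; [left; exists X|right].
  have big : Y `<=` X `|` I -> exists Y, [/\ proper_t_ideal D Y,
      Y `<=` \bigcup_(X in F) X `|` I, I `<=` Y, [set` x :: s] `<=` Y &
      Y = I \/ exists2 X, F X & Y = X `|` I].
    move=> YX; exists (X `|` I); split=> //.
    - exact: FP.
    - by apply/set_cons_sub; split; [left|exact: subset_trans YX].
    - by right; exists X.
  case: YF => [YI|[Z FZ YZ]]; first by apply: big; rewrite YI => y; right.
  have [XZ|ZX] := Ftot _ _ FX FZ; last first.
    by apply: big; rewrite YZ; exact: setSU.
  exists Y; split=> //; last by right; exists Z.
  by apply/set_cons_sub; split=> //; rewrite YZ; left; exact: XZ.
have [[[Imod ID] I0 _] _] := Ip.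
rewrite /P; set U := _ `|` I in listP *.
have UD : U `<=` D.
  by move=> x [[X /FP[[[_ +] _ _] _] Xx]|/ID //]; apply; left.
have [[D0 DD _] _] := Dring.
have proper_ideal1 Y : proper_t_ideal D Y -> ~ Y 1.
  by move=> [[Yid _ _] YD] /(ideal1 Yid).
split.
  apply/t_idealP; split; last 1 first.
  - move=> s /listP[Y [[/t_idealP[_ _ Yt] _] YU _ sY _]].
    by apply: subset_trans YU; exact: Yt.
  - split=> //; split.
    + by right; have [] := Imod.
    + move=> x y Ux Uy; have [|Y [[[[[_ YA _] _] _ _] _] YU _ xyY _]] := listP [:: x; y].
        by apply/set_cons_sub; split=> //; exact/set_cons_sub.
      by apply: YU; apply: YA; apply: xyY; rewrite /= !inE eqxx ?orbT.
    + move=> a x Da Ux; have [|Y [[[[[_ _ YM] _] _ _] _] YU _ xY _]] := listP [:: x].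
        exact/set_cons_sub.
      by apply: YU; apply: YM => //; apply: xY; rewrite /= inE.
  - by have [x Ix x0] := I0; exists x => //; right.
move=> UD'; have [|Y [Yp YU _ Y1 _]] := listP [:: 1].
  by apply/set_cons_sub; split=> //; rewrite UD'; have [] := Dring.
by apply: (proper_ideal1 _ Yp); apply: Y1; rewrite /= inE.
Qed.

End Closure.

(** * t-maximal ideals and localization at them *)

Section TMaximal.
Variables (K : fieldType) (D : set K).
Hypothesis Dring : subsemiring D.

Let DM x y : D x -> D y -> D (x * y).
Proof. by have [[_ _ h] _] := Dring; exact: h. Qed.
Let D1 : D 1. Proof. by have [] := Dring. Qed.

Section Maximal.
Variable m : set K.
Hypothesis mmax : t_maximal D m.

Lemma tmax_ideal : ideal D m.
Proof. by have [[[]]] := mmax. Qed.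

Lemma tmax_sub : m `<=` D.
Proof. by have [] := tmax_ideal. Qed.

Lemma tmax_submodule : submodule D m.
Proof. by have [] := tmax_ideal. Qed.

Lemma tmax0 : m 0.
Proof. by have [] := tmax_submodule. Qed.

Lemma tmax_mul a x : D a -> m x -> m (a * x).
Proof. by have [_ _] := tmax_submodule; apply. Qed.

Lemma tmax1 : ~ m 1.
Proof. by move=> /(ideal1 tmax_ideal); have [[]] := mmax. Qed.

Lemma tmax_vlist (s : seq K) : [set` s] `<=` m -> vlist D s `<=` m.
Proof. by have [[/(t_idealP Dring)[_ _ +] _] _] := mmax; apply. Qed.

Lemma tmax_nonzero : nonzero m.
Proof. by have [[[_]]] := mmax. Qed.

Lemma notin_tmax_neq0 x : ~ m x -> x != 0.
Proof. by move=> mx; apply/eqP => x0; apply: mx; rewrite x0; exact: tmax0. Qed.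

(** By maximality the t-closure of m + aD is [D]; each entry u + a d of a witnessing list lies in
    the v-closure of u and a. *)
Lemma tmax_comax a : D a -> ~ m a ->
  exists2 s, [set` s] `<=` m & vlist D (a :: s) 1.
Proof.
move=> Da ma; have [m0 mD mM] := tmax_submodule.
have [[D0 DD _] _] := Dring.
pose P := [set x | exists u d, [/\ m u, D d & x = u + a * d]].
have Pid : ideal D P.
  split; last first.
    by move=> _ [u [d [mu Dd ->]]]; apply: DD; [exact: tmax_sub|exact: DM].
  split.
  - by exists 0, 0; rewrite mulr0 addr0.
  - move=> _ _ [u [d [mu Dd ->]]] [v [e [mv De ->]]].
    exists (u + v), (d + e); split; [exact: mD|exact: DD|].
    by rewrite mulrDr addrACA.
  - move=> b _ Db [u [d [mu Dd ->]]]; exists (b * u), (b * d).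
    by split; [exact: mM|exact: DM|rewrite mulrDr mulrCA].
have mP : m `<=` P by move=> x mx; exists x, 0; rewrite mulr0 addr0.
have Pa : P a by exists 0, 1; rewrite mulr1 add0r.
have P0 : nonzero P by have [x /mP Px x0] := tmax_nonzero; exists x.
have [Pmod _] := Pid; have PT := sub_t_closure Dring Pmod P0.
have TD : t_closure D P = D.
  apply: contrapT => nTD; have [_ maxm] := mmax; apply: ma.
  rewrite -(maxm (t_closure D P)); [exact: PT| |exact: subset_trans PT].
  by split=> //; exact: t_closure_t_ideal.
have /(t_closureP Dring _ Pmod P0)[s' s'P s'1] : t_closure D P 1 by rewrite TD.
have [y /s'P[u [d [mu Dd ->]]]|s sma s's] := @vlist_merge _ D (m `|` [set a]) s'.
  exists [:: u; a].
    by apply/set_cons_sub; split; [left|apply/set_cons_sub; split=> //; right].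
  have [_ vD vM] := vlist_submodule Dring [:: u; a]; apply: vD.
    by apply: vlist_mem; rewrite /= !inE eqxx.
  by rewrite mulrC; apply: vM => //; apply: vlist_mem; rewrite /= !inE eqxx orbT.
(* Entries of the merged list are in [m] or equal to [a]; the latter are dropped. *)
exists [seq y <- s | y != a].
  by move=> y /=; rewrite mem_filter => /andP[/eqP ya /sma[]].
apply: vlist_trans s'1; apply: subset_trans s's _; apply: vlist_sub => y /= ys.
by rewrite inE mem_filter ys andbT orbN.
Qed.

(** If neither is in [m], the relations from [tmax_comax] for a and b combine to give 1 in the
    v-closure of a b, b s and s', a list inside [m]. *)
Lemma tmax_prime a b : D a -> D b -> m (a * b) -> m a \/ m b.
Proof.
move=> Da Db mab; apply: contrapT => /not_orP[ma mb].
have [s sm s1] := tmax_comax Da ma; have [s' s'm s'1] := tmax_comax Db mb.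
apply: tmax1; apply: (@tmax_vlist (a * b :: map ( *%R b) s ++ s')).
  apply/set_cons_sub; split=> //; apply/set_cat_sub; split=> //.
  by apply/set_map_sub => y /sm; exact: tmax_mul.
move=> x xL; apply: s'1 => y; rewrite inE => /predU1P[->|ys']; last first.
  by apply: xL; rewrite inE mem_cat ys' !orbT.
rewrite -[x * b]mulr1; apply: s1 => z; rewrite inE => /predU1P[->|zs].
  by rewrite mulrAC -mulrA; apply: xL; rewrite mem_head.
by rewrite -mulrA; apply: xL; rewrite inE mem_cat map_f ?orbT.
Qed.

Lemma tmax_notin_mul a b : D a -> ~ m a -> D b -> ~ m b -> ~ m (a * b).
Proof. by move=> Da ma Db mb /(tmax_prime Da Db)[]. Qed.

Lemma locP x : localization D m x <-> exists s, [/\ D s, ~ m s & D (s * x)].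
Proof.
split=> [[a [s [Da Ds ms ->]]]|[s [Ds ms Dsx]]].
  by exists s; split=> //; rewrite mulrC divfK // notin_tmax_neq0.
by exists (s * x), s; split=> //; rewrite mulrAC divff ?mul1r // notin_tmax_neq0.
Qed.

Lemma sub_loc : D `<=` localization D m.
Proof. by move=> x Dx; apply/locP; exists 1; rewrite mul1r; split=> //; exact: tmax1. Qed.

Lemma loc_inv s : D s -> ~ m s -> localization D m s^-1.
Proof.
by move=> Ds ms; apply/locP; exists s; rewrite divff // notin_tmax_neq0.
Qed.

Lemma loc_subsemiring : subsemiring (localization D m).
Proof.
have [[D0 DD _] _] := Dring; split; last exact: sub_loc.
split.
- exact: sub_loc.
- move=> x y /locP[s [Ds ms Dsx]] /locP[t [Dt mt Dty]]; apply/locP.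
  exists (s * t); split; [exact: DM|exact: tmax_notin_mul|].
  by rewrite mulrDr -!mulrA (mulrCA s t x); apply: DD; exact: DM.
- move=> x y /locP[s [Ds ms Dsx]] /locP[t [Dt mt Dty]]; apply/locP.
  exists (s * t); split; [exact: DM|exact: tmax_notin_mul|].
  by rewrite mulrACA; exact: DM.
Qed.

(** As [m] is prime, the product of the individual denominators stays outside [m]. In the
    applications [P] is [D] or [m]. *)
Lemma common_denominator (T : eqType) (f : T -> K) (P : set K) (l : seq T) :
    (forall a x, D a -> P x -> P (a * x)) ->
    (forall y, y \in l -> exists s, [/\ D s, ~ m s & P (s * f y)]) ->
  exists s, [/\ D s, ~ m s & forall y, y \in l -> P (s * f y)].
Proof.
move=> PM; elim: l => [_|x l IH h]; first by exists 1; split=> //; exact: tmax1.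
have [|s [Ds ms Psl]] := IH; first by move=> y yl; apply: h; rewrite inE yl orbT.
have [|t [Dt mt Ptx]] := h x; first by rewrite mem_head.
exists (s * t); split; [exact: DM|exact: tmax_notin_mul|].
move=> y; rewrite inE => /predU1P[->|yl]; first by rewrite -mulrA; exact: PM.
by rewrite (mulrC s) -mulrA; apply: PM => //; exact: Psl.
Qed.

Lemma extensionP (I : set K) x : submodule D I ->
  (extension D m I x <-> exists s, [/\ D s, ~ m s & I (s * x)]).
Proof.
move=> [I0 ID IM]; split; last first.
  move=> [s [Ds ms Isx]]; rewrite -[x](mulKf (notin_tmax_neq0 ms)) mulrC.
  by apply: prod_ideal_mul => //; exact: loc_inv.
apply: (@prod_ideal_sub _ _ _ [set x | exists s, [/\ D s, ~ m s & I (s * x)]]).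
- by exists 1; rewrite mulr0; split=> //; exact: tmax1.
- move=> y z [s [Ds ms Isx]] [t [Dt mt Itz]].
  exists (s * t); split; [exact: DM|exact: tmax_notin_mul|].
  by rewrite mulrDr -!mulrA (mulrCA s t y); apply: ID; exact: IM.
- move=> y z Iy /locP[s [Ds ms Dsz]]; exists s; split=> //.
  by rewrite /= mulrCA mulrC; exact: IM.
Qed.

Lemma sub_extension (I : set K) : I `<=` extension D m I.
Proof.
by move=> x Ix; rewrite -[x]mulr1; apply: prod_ideal_mul => //; exact: sub_loc.
Qed.

Lemma extension_submodule (I : set K) :
  submodule (localization D m) (extension D m I).
Proof. by apply: prod_ideal_submoduler; have [] := loc_subsemiring. Qed.

Lemma extension_ideal (I : set K) :
  ideal D I -> ideal (localization D m) (extension D m I).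
Proof.
move=> [Imod ID]; split; first exact: extension_submodule.
by move=> x /(extensionP _ Imod)[s [Ds ms /ID Dsx]]; apply/locP; exists s.
Qed.

Lemma extension_nonzero (I : set K) : nonzero I -> nonzero (extension D m I).
Proof. by move=> [x Ix x0]; exists x => //; exact: sub_extension. Qed.

Lemma inv_extension (I : set K) w : submodule D I ->
  (inv_ideal (localization D m) (extension D m I) w <->
   forall y, I y -> localization D m (w * y)).
Proof.
move=> Imod; split=> [h y Iy|h x]; first by apply: h; exact: sub_extension.
move=> /(extensionP _ Imod)[s [Ds ms /h/locP[t [Dt mt]]]].
rewrite (mulrCA w) (mulrA t) => Dtswx; apply/locP; exists (t * s).
by split=> //; [exact: DM|exact: tmax_notin_mul].
Qed.

Lemma extension_span (s : seq K) :
  extension D m (span D s) = span (localization D m) s.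
Proof.
have lr := loc_subsemiring; have smod := span_submodule Dring s.
apply/seteqP; split=> [x /(extensionP _ smod)[t [Dt mt stx]]|].
  have -> : x = t^-1 * (t * x) by rewrite mulKf // notin_tmax_neq0.
  have [_ _ +] := span_submodule lr s; apply; first exact: loc_inv.
  by have [c Dc ->] := stx; exists c => // i; exact: sub_loc.
apply: span_sub; first exact: extension_submodule.
by move=> x xs; apply: sub_extension; exact: span_mem.
Qed.


End Maximal.

Lemma tmax_eq m n : t_maximal D m -> t_maximal D n -> m `<=` n -> n = m.
Proof. by move=> [_ mmax] [np _]; exact: mmax. Qed.

Lemma tmax_sep m n : t_maximal D m -> t_maximal D n -> m <> n ->
  exists2 a, m a & ~ n a.
Proof.
move=> mm nm mn; apply: contrapT => h; apply: mn; apply/esym/tmax_eq => // a ma.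
by apply: contrapT => na; apply: h; exists a.
Qed.

(** A t-closure other than [D] would be a proper t-ideal, so [P] would lie in a t-maximal ideal. *)
Lemma t_closure1 (P : set K) : ideal D P -> nonzero P ->
    (forall m, t_maximal D m -> exists2 p, P p & ~ m p) ->
  exists2 s, [set` s] `<=` P & vlist D s 1.
Proof.
move=> Pid P0 h; have [Pmod _] := Pid; apply/(t_closureP Dring _ Pmod P0).
have Tid := t_closure_t_ideal Dring Pid P0.
have [TD|/(conj Tid)/(t_max_above Dring)[m mm Tm]] := pselect (t_closure D P = D).
  by rewrite TD.
have [p Pp []] := h _ mm; apply: Tm; exact: sub_t_closure.
Qed.

End TMaximal.

(** * Comparing [D] with its localizations *)

Section QuotientField.
Variables (K : fieldType) (D : set K).
Hypothesis Dring : subsemiring D.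
Hypothesis Dfrac : forall x : K, exists s, [/\ D s, s != 0 & D (s * x)].

Let DM x y : D x -> D y -> D (x * y).
Proof. by have [[_ _ h] _] := Dring; exact: h. Qed.

Lemma loc_divide m a z : t_maximal D m -> D a -> ~ m a -> D (z * a) ->
  localization D m z.
Proof. by move=> mm Da ma Dza; apply/(locP mm); exists a; rewrite mulrC. Qed.

(** The ideal of denominators of [x] lies in no t-maximal ideal, so 1 is in the v-closure of
    finitely many of them; multiplication by [x] sends these into [D], hence 1 as well. *)
Lemma bigcap_loc x : (forall m, t_maximal D m -> localization D m x) -> D x.
Proof.
move=> locx; have [[D0 DD _] _] := Dring.
pose P := [set d | D d /\ D (d * x)].
have Pid : ideal D P.
  split; last by move=> d [].
  split=> [|a b [Da Dax] [Db Dbx]|a b Da [Db Dbx]].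
  - by split; rewrite ?mul0r.
  - by split; rewrite ?mulrDl; exact: DD.
  - by split; rewrite -?mulrA; exact: DM.
have P0 : nonzero P by have [s [Ds s0 Dsx]] := Dfrac x; exists s.
have [m mm|s sP s1] := t_closure1 Dring Pid P0.
  by have /(locP mm)[s [Ds ms Dsx]] := locx m mm; exists s.
by rewrite -[x]mulr1; apply: s1 => y /sP[_]; rewrite mulrC.
Qed.

(** Since [m] is closed under sums, an element of the product outside [m] forces a single term i w
    outside [m]. This turns t-invertibility into a test at each t-maximal ideal. *)
Lemma t_invertible_tmaxP (I : set K) : ideal D I -> nonzero I ->
  (t_invertible D I <-> forall m, t_maximal D m ->
    exists i w, [/\ I i, inv_ideal D I w & ~ m (i * w)]).
Proof.
move=> Iid I0; split=> [/(t_invertibleP Dring Iid I0)[s sP s1] m mm|h].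
  apply: contrapT => h; apply: (tmax1 mm); apply: tmax_vlist s1 => //.
  apply: subset_trans sP _; apply: prod_ideal_sub.
  - exact: (tmax0 mm).
  - by have [] := tmax_submodule mm.
  - by move=> i w Ii Iw; apply: contrapT => miw; apply: h; exists i, w.
apply/t_invertibleP => //; apply: t_closure1 => //.
- exact: prod_inv_ideal.
- exact: prod_inv_nonzero.
- move=> m /h[i [w [Ii Iw miw]]]; exists (i * w) => //; exact: prod_ideal_mul.
Qed.

(* Enlarging s by an element of m and by separators from the finitely many
   other t-maximal ideals containing it makes m the only relevant one. *)
Lemma tmax_well_behaved (m : set K) (s : seq K) :
    t_finite_character D -> t_maximal D m ->
    (forall y, y \in s -> exists t, [/\ D t, ~ m t & m (t * y)]) ->
  ~ vlist (localization D m) s 1.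
Proof.
move=> fin mm /(common_denominator Dring mm)[|t [Dt mt mts]].
  by move=> a y; exact: (tmax_mul mm).
move=> s1; have [x mx x0] := tmax_nonzero mm; have Dx := tmax_sub mm mx.
have /finite_seqP[ns nsP] := fin x Dx x0.
have /choice[f fP] : forall n : set K, exists a : K,
    m a /\ (t_maximal D n -> n <> m -> ~ n a).
  move=> n.
  have [[nm nn]|h] := pselect (t_maximal D n /\ n <> m); last first.
    by exists 0; split=> [|nm nn]; [exact: (tmax0 mm)|case: h].
  by have [a ma na] := tmax_sep mm nm (nesym nn); exists a.
apply: (tmax1 mm).
apply: (@tmax_vlist _ _ Dring m mm (map ( *%R t) s ++ x :: map f ns)).
  apply/set_cat_sub; split; first by apply/set_map_sub => y /mts.
  apply/set_cons_sub; split=> //; apply/set_map_sub => n _; exact: (fP n).1.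
(* Any [z] carrying the list into [D] is itself in [D]: it is local at [m] by the entries from [s],
   at another [n] containing [x] by the entry [f n], and elsewhere by [x]. *)
move=> z hz; rewrite mulr1; apply: bigcap_loc => n nm.
have [->|nn] := pselect (n = m).
  rewrite -[z]mulr1; apply: s1 => y ys.
  rewrite -[z * y](mulKf (notin_tmax_neq0 mm mt)).
  have [[_ _ lM] _] := loc_subsemiring Dring mm; apply: lM.
    exact: loc_inv.
  apply: sub_loc => //; rewrite mulrCA; apply: hz.
  by rewrite mem_cat map_f.
have [nx|nx] := pselect (n x).
  have nns : n \in ns by have : [set` ns] n by rewrite -nsP.
  apply: (loc_divide (a := f n)) => //; first exact: tmax_sub mm _ (fP n).1.
    exact: (fP n).2.
  by apply: hz; rewrite mem_cat inE map_f ?orbT.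
by apply: (loc_divide (a := x)) => //; apply: hz; rewrite mem_cat inE eqxx orbT.
Qed.

(** The product i w is a unit of the localization. If all such products were in [m], every entry of
    [s] would be carried into [m] by some denominator outside [m], against [tmax_well_behaved]. *)
Lemma t_locally_t_invertible_inv (m I : set K) :
    t_finite_character D -> t_maximal D m -> ideal D I -> nonzero I ->
    t_invertible (localization D m) (extension D m I) ->
  exists i w, [/\ I i, forall y, I y -> localization D m (w * y),
                  D (i * w) & ~ m (i * w)].
Proof.
move=> fin mm Iid I0; have [Imod ID] := Iid.
have lring := loc_subsemiring Dring mm.
have eid := extension_ideal Dring mm Iid.
have e0 := extension_nonzero Dring mm I0.
move=> /(t_invertibleP lring eid e0)[s sP s1].
apply: contrapT => h; apply: (tmax_well_behaved fin mm _ s1) => y /sP.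
apply: (@prod_ideal_sub _ _ _ [set y | exists t, [/\ D t, ~ m t & m (t * y)]]).
- exists 1; rewrite mulr0.
  by split; [have [] := Dring|exact: (tmax1 mm)|exact: (tmax0 mm)].
- move=> a b [t [Dt mt mta]] [r [Dr mr mrb]]; exists (t * r).
  split; [exact: DM|exact: (tmax_notin_mul Dring mm)|].
  have [_ mD _] := tmax_submodule mm.
  by rewrite mulrDr -!mulrA (mulrCA t r a); apply: mD; exact: (tmax_mul mm).
- move=> i w /(extensionP Dring mm _ Imod)[t [Dt mt Iti]] iw.
  have /(locP mm)[r [Dr mr Driw]] : localization D m (i * w).
    apply: (@prod_inv_integral _ _ lring (extension D m I)); apply: prod_ideal_mul => //.
    by apply/extensionP => //; exists t.
  exists (t * r); split; [exact: DM|exact: (tmax_notin_mul Dring mm)|].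
  (* Clearing denominators puts t i in [I] and keeps r w in the inverse of the extension, so a
     product outside [m] is one that [h] excludes. *)
  apply: contrapT => nm; apply: h; exists (t * i), (r * w).
  have E : t * i * (r * w) = t * r * (i * w) by rewrite mulrACA.
  rewrite E; split=> //; last by rewrite -mulrA; exact: DM.
  move=> z Iz; rewrite -mulrA.
  have [[_ _ lM] _] := lring; apply: lM; first exact: sub_loc.
  by apply: iw; exact: sub_extension.
Qed.

(** * From the t-finite character to a PvMD, and from there to (i) *)

Lemma t_finite_character_PvMD :
  t_locally_PvMD D -> t_finite_character D -> PvMD D.
Proof.
move=> lPvMD fin I Iid I0 [s Is]; apply/t_invertible_tmaxP => // m mm.
have eid := extension_ideal Dring mm Iid.
have e0 := extension_nonzero Dring mm I0.
have etinv : t_invertible (localization D m) (extension D m I).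
  by apply: lPvMD => //; exists s; rewrite Is; exact: extension_span.
have [i [w [Ii Iw Diw miw]]] := t_locally_t_invertible_inv fin mm Iid I0 etinv.
have sI : [set` s] `<=` I by rewrite Is; exact: span_mem.
(* Finite generation enters here: one [t] outside [m] moves [w] from the local inverse of [I] into
   the global one. *)
have [|y ys|t [Dt mt Dtw]] := @common_denominator _ _ Dring m mm K ( *%R w) D s.
- exact: DM.
- by apply/(locP mm); exact/Iw/sI.
exists i, (t * w); split=> //.
  by rewrite Is; apply/inv_span => // y ys; rewrite -mulrA; exact: Dtw.
by rewrite mulrCA; exact: (tmax_notin_mul Dring mm).
Qed.

Lemma PvMD_t_finite_character_t_invertible (I : set K) :
    PvMD D -> t_finite_character D ->
  t_ideal D I -> t_locally_t_invertible D I -> t_invertible D I.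
Proof.
move=> pvmd fin /(t_idealP Dring)[Iid I0 It] Iloc; have [Imod ID] := Iid.
have [x Ix x0] := I0; have Dx := ID _ Ix.
have /finite_seqP[ns nsP] := fin x Dx x0.
(* At a t-maximal ideal [f m] generates [I] locally; [x] is the default value elsewhere. *)
have /choice[f fP] : forall m : set K, exists i : K, I i /\ (t_maximal D m ->
    exists w, [/\ forall y, I y -> localization D m (w * y),
                  D (i * w) & ~ m (i * w)]).
  move=> m; have [mm|nm] := pselect (t_maximal D m); last by exists x.
  have [i [w [Ii Iw Diw miw]]] :=
    t_locally_t_invertible_inv fin mm Iid I0 (Iloc m mm).
  by exists i; split=> // _; exists w.
pose s := x :: map f ns.
have sI : [set` s] `<=` I.
  by apply/set_cons_sub; split=> //; apply/set_map_sub => m _; exact: (fP m).1.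
(* The list [s] has the same inverse as [I]: at each [m] either [x] is a unit or [m] is listed in
   [ns] and [f m] generates [I] locally. *)
have inv_s z : (forall y, y \in s -> D (z * y)) -> inv_ideal D I z.
  move=> zs y Iy; apply: bigcap_loc => m mm.
  have lring := loc_subsemiring Dring mm; have [[_ _ lM] _] := lring.
  have [mx|mx] := pselect (m x); last first.
    apply: lM; last exact/sub_loc/ID.
    by apply: (loc_divide (a := x)) => //; apply: zs; rewrite mem_head.
  have mns : m \in ns by have : [set` ns] m by rewrite -nsP.
  have [w [Iw Dw mw]] := (fP m).2 mm.
  have -> : z * y = (f m * w)^-1 * ((z * f m) * (w * y)).
    by rewrite (mulrC z (f m)) mulrACA mulKf // (notin_tmax_neq0 mm).
  apply: (lM); [exact: loc_inv|apply: (lM); [apply: sub_loc => //|exact: Iw]].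
  by apply: zs; rewrite inE map_f ?orbT.
have sid : ideal D (span D s).
  split; first exact: span_submodule.
  by apply: subset_trans ID; exact: span_sub.
have s0 : nonzero (span D s) by exists x => //; apply: span_mem; rewrite //= mem_head.
apply/t_invertible_tmaxP => // m mm.
have [|i [w [si sw miw]]] := (t_invertible_tmaxP sid s0).1 _ m mm.
  by apply: pvmd => //; exists s.
exists i, w; split=> //; first exact: span_sub sI _ si.
by apply: inv_s; exact/(inv_span Dring).
Qed.

(** * Condition (i) and finitely generated ideals *)

Lemma t_closure_t_locally_t_invertible (m I : set K) : t_maximal D m ->
    ideal D I -> nonzero I ->
    t_invertible (localization D m) (extension D m I) ->
  t_invertible (localization D m) (extension D m (t_closure D I)).
Proof.
move=> mm Iid I0; have [Imod ID] := Iid; have IT := sub_t_closure Dring Imod I0.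
have /(t_idealP Dring)[Tid T0 _] := t_closure_t_ideal Dring Iid I0.
have lring := loc_subsemiring Dring mm; have [Tmod _] := Tid.
move=> /(t_invertibleP lring (extension_ideal Dring mm Iid)
  (extension_nonzero Dring mm I0))[s sP s1].
apply/(t_invertibleP lring (extension_ideal Dring mm Tid)
  (extension_nonzero Dring mm T0)); exists s => //.
have [P0 PD _] := prod_ideal_submodule
  (inv_ideal (localization D m) (extension D m (t_closure D I)))
  (extension_submodule Dring mm (t_closure D I)).
apply: subset_trans sP _; apply: prod_ideal_sub => // i w.
move=> /(extensionP Dring mm _ Imod)[t [Dt mt /IT Tti]].
move=> /(inv_extension Dring mm _ Imod) Iw; apply: prod_ideal_mul.
  by apply/(extensionP Dring mm) => //; exists t.
(* The local inverse of [I] also works for its t-closure: y is controlled by a finite list [l],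
   whose products with [w] have a common denominator. *)
apply/(inv_extension Dring mm) => // y /(t_closureP Dring _ Imod I0)[l lI ly].
have [|z zl|r [Dr mr Drw]] := @common_denominator _ _ Dring m mm K ( *%R w) D l.
- exact: DM.
- by apply/(locP mm); exact/Iw/lI.
- apply/(locP mm); exists r; split=> //; rewrite mulrA; apply: ly => z zl.
  by rewrite -mulrA; exact: Drw.
Qed.

(** Let i w be outside [m] with i in the v-closure of a list [s] in [I]. If w s were inside [m], so
    would be w i; hence some entry of [s] can replace i. *)
Lemma t_closure_t_invertible (I : set K) : ideal D I -> nonzero I ->
  t_invertible D (t_closure D I) -> t_invertible D I.
Proof.
move=> Iid I0; have [Imod ID] := Iid; have IT := sub_t_closure Dring Imod I0.
have /(t_idealP Dring)[Tid T0 _] := t_closure_t_ideal Dring Iid I0.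
move=> /(t_invertible_tmaxP Tid T0) h; apply/t_invertible_tmaxP => // m mm.
have [i [w [/(t_closureP Dring _ Imod I0)[s sI si] Tw miw]]] := h m mm.
have Iw : inv_ideal D I w by move=> y /IT/Tw.
apply: contrapT => nex; apply: miw; rewrite mulrC.
apply: (tmax_vlist Dring mm _ (vlist_scale (w := w) si)).
apply/set_map_sub => y ys; apply: contrapT => mwy; apply: nex.
by exists y, w; split=> //; [exact: sI|rewrite mulrC].
Qed.

(** The hypothesis speaks of t-ideals only, so it is applied to the t-closure of [I], whose local
    t-invertibility comes from [I] and whose t-invertibility descends to [I]. *)
Lemma bazzoni_PvMD : t_locally_PvMD D ->
    (forall I, t_ideal D I -> t_locally_t_invertible D I -> t_invertible D I) ->
  PvMD D.
Proof.
move=> lPvMD baz I Iid I0 [s Is]; apply: t_closure_t_invertible => //.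
apply: baz; first exact: t_closure_t_ideal.
move=> m mm; apply: t_closure_t_locally_t_invertible => //; apply: lPvMD => //.
- exact: extension_ideal.
- exact: extension_nonzero.
- by exists s; rewrite Is; exact: extension_span.
Qed.

End QuotientField.

(** * Infinitely many pairwise disjoint lists *)

Section Disjoint.
Variables (K : fieldType) (D : set K).
Hypothesis Dring : subsemiring D.
Hypothesis Dfrac : forall x : K, exists s, [/\ D s, s != 0 & D (s * x)].

(** As w s is in [D] and a w is a unit at [m], the entry a generates s locally. An entry suffices
    because w times a combination can leave [m] only if w times some entry does. *)
Lemma PvMD_locally_principal (m : set K) (s : seq K) x : PvMD D -> t_maximal D m ->
    [set` s] `<=` D -> x \in s -> x != 0 ->
  exists a w, [/\ a \in s, forall y, y \in s -> D (w * y) & ~ m (a * w)].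
Proof.
move=> pvmd mm sD xs x0; have [Dmod _] := Dring.
have Iid : ideal D (span D s) by split; [exact: span_submodule|exact: span_sub].
have I0 : nonzero (span D s) by exists x => //; exact: span_mem.
have [|i [w [Ii Iw miw]]] := (t_invertible_tmaxP Dring Iid I0).1 _ m mm.
  by apply: pvmd => //; exists s.
have {}Iw := (inv_span Dring s w).1 Iw.
apply: contrapT => h; apply: miw; rewrite mulrC.
apply: (span_sub (preim_mul_submodule w (tmax_submodule mm)) _ Ii) => y ys /=.
by apply: contrapT => mwy; apply: h; exists y, w; split=> //; rewrite mulrC.
Qed.

Lemma disjoint_lists (x : K) : D x ->
    infinite_set [set m | t_maximal D m /\ m x] ->
  exists e : nat -> seq K, [/\ forall i, [set` e i] `<=` D, forall i, x \in e i,
    forall i, exists2 m, t_maximal D m & [set` e i] `<=` m &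
    forall m i j, t_maximal D m -> [set` e i] `<=` m -> [set` e j] `<=` m -> i = j].
Proof.
move=> Dx Minf; set M := [set m | _] in Minf.
pose iso := [set m | M m /\ exists s : seq K, [set` s] `<=` m /\
  forall n, t_maximal D n -> [set` s] `<=` n -> n = m].
(* Isolating lists of distinct ideals have no common t-maximal ideal; [x] may be added to them, as
   each of these ideals contains it. *)
have [isofin|/infiniteP/pcard_leP[f]] := pselect (finite_set iso); last first.
  have fiso i : iso (f i) by exact: funS.
  have finj : injective f by move=> i j; apply: (@inj _ _ _ f); rewrite inE.
  have /choice[e eP] i := (fiso i).2.
  exists (fun i => x :: e i); split=> [i|i|i|m i j mm].
  - have [[fm fx] _] := fiso i; apply/set_cons_sub; split=> //.
    by apply: subset_trans (tmax_sub fm); exact: (eP i).1.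
  - exact: mem_head.
  - have [[fm fx] _] := fiso i; exists (f i) => //.
    by apply/set_cons_sub; split=> //; exact: (eP i).1.
  - move=> /set_cons_sub[_ /(eP i).2-/(_ mm) mi] /set_cons_sub[_ /(eP j).2-/(_ mm)].
    by rewrite mi => /finj.
(* Otherwise only lists avoiding all isolated ideals are used; enlarging one keeps this property as
   long as some t-maximal ideal contains it. *)
pose good (G : seq K) := [/\ [set` G] `<=` D, x \in G,
  exists2 m, t_maximal D m & [set` G] `<=` m &
  forall m, iso m -> ~ [set` G] `<=` m].
have good_mono (G G' : seq K) m : good G -> [set` G] `<=` [set` G'] ->
    t_maximal D m -> [set` G'] `<=` m -> good G'.
  move=> [GD Gx _ Giso] GG' mm G'm; split.
  - exact: subset_trans (tmax_sub mm).
  - exact: GG'.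
  - by exists m.
  - by move=> n /Giso Gn G'n; apply: Gn; exact: subset_trans G'n.
have [G0 G0good] : exists G, good G.
  (* A non-isolated [m] is left over; for each isolated ideal an element of [m] outside it goes into
     the list. *)
  have [m [[mm mx] miso]] := infinite_setN0 (infinite_setD Minf isofin).
  have /finite_seqP[ns nsP] := isofin.
  have /choice[a aP] : forall n, exists a, m a /\ (iso n -> ~ n a).
    move=> n; have [nis|nis] := pselect (iso n); last by exists x.
    have [nm _] := nis.1; have [mn|a ma na] := tmax_sep mm nm.
      by case: miso; rewrite mn.
    by exists a.
  have Gm : [set` x :: map a ns] `<=` m.
    by apply/set_cons_sub; split=> //; apply/set_map_sub => n _; exact: (aP n).1.
  exists (x :: map a ns); split.
  - exact: subset_trans (tmax_sub mm).
  - exact: mem_head.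
  - by exists m.
  - move=> n nis /set_cons_sub[_ /set_map_sub] h; apply: (aP n).2 => //.
    by apply: h; have : [set` ns] n by rewrite -nsP.
have /choice[step stepP] : forall G : seq K, exists p : seq K * seq K, good G ->
    [/\ good p.1, good p.2, [set` G] `<=` [set` p.1], [set` G] `<=` [set` p.2] &
      forall m, t_maximal D m -> [set` p.1] `<=` m -> [set` p.2] `<=` m -> False].
  move=> G; have [gG|] := pselect (good G); last by exists ([::], [::]).
  have [_ Gx [m mm Gm] Giso] := gG.
  (* A second t-maximal ideal over [G] exists, since otherwise [G] would isolate [m]. *)
  have [n nm [Gn mn]] : exists2 n, t_maximal D n & [set` G] `<=` n /\ m <> n.
    apply: contrapT => h; apply: (Giso m) => //.
    split; first by split=> //; exact: Gm.
    exists G; split=> // n nm Gn; apply: contrapT => nn; apply: h.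
    by exists n => //; split=> // mn; apply: nn.
  have [a ma na] := tmax_sep mm nm mn.
  have Da := tmax_sub mm ma.
  (* No t-maximal ideal contains both [a] and [s], so adding [a] to one copy of [G] and [s] to
     another splits it. *)
  have [s sn s1] := tmax_comax Dring nm Da na.
  have G1m : [set` a :: G] `<=` m by apply/set_cons_sub.
  have G2n : [set` s ++ G] `<=` n by apply/set_cat_sub.
  have GG1 : [set` G] `<=` [set` a :: G] by move=> y /= yG; rewrite inE yG orbT.
  have GG2 : [set` G] `<=` [set` s ++ G] by move=> y /= yG; rewrite mem_cat yG orbT.
  exists (a :: G, s ++ G) => _; split=> //=.
  - exact: good_mono gG GG1 mm G1m.
  - exact: good_mono gG GG2 nm G2n.
  - move=> k km /set_cons_sub[ka _] /set_cat_sub[ks _]; apply: (tmax1 km).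
    by apply: (tmax_vlist Dring km _ s1); exact/set_cons_sub.
(* The first half is split again at each stage and the second halves form the sequence: each
   contains the first half of every earlier stage. *)
pose g n := iter n (fun G => (step G).1) G0.
have ggood n : good (g n) by elim: n => //= n /stepP[].
have gmono i j : (i <= j)%N -> [set` g i] `<=` [set` g j].
  move=> /subnK <-; elim: (j - i)%N => // k IH; apply: subset_trans IH _.
  by have [] := stepP _ (ggood (k + i)%N).
have edisj m i j : t_maximal D m -> (i < j)%N ->
    [set` (step (g i)).2] `<=` m -> [set` (step (g j)).2] `<=` m -> False.
  move=> mm ij im jm; have [_ _ _ _ /(_ m mm)] := stepP _ (ggood i); apply=> //.
  apply: subset_trans (gmono i.+1 j ij) _; apply: subset_trans jm.
  by have [] := stepP _ (ggood j).
exists (fun i => (step (g i)).2); split=> [i|i|i|m i j mm im jm].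
- by have [_ []] := stepP _ (ggood i).
- by have [_ []] := stepP _ (ggood i).
- by have [_ []] := stepP _ (ggood i).
- by case: (ltngtP i j) => // ij; [case: (edisj m i j)|case: (edisj m j i)].
Qed.

End Disjoint.

(** * A t-locally t-invertible t-ideal that is not t-invertible *)

Section BazzoniFiniteCharacter.
Variables (K : fieldType) (D : set K).
Hypothesis Dring : subsemiring D.
Hypothesis Dfrac : forall x : K, exists s, [/\ D s, s != 0 & D (s * x)].
Hypothesis pvmd : PvMD D.
Variables (x : K) (e : nat -> seq K).
Hypotheses (Dx : D x) (x0 : x != 0).
Hypothesis eD : forall i, [set` e i] `<=` D.
Hypothesis ex : forall i, x \in e i.
Hypothesis e_proper : forall i, exists2 m, t_maximal D m & [set` e i] `<=` m.
Hypothesis e_disjoint : forall m i j, t_maximal D m ->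
  [set` e i] `<=` m -> [set` e j] `<=` m -> i = j.

Let DM a b : D a -> D b -> D (a * b).
Proof. by have [[_ _ h] _] := Dring; exact: h. Qed.

(* The inverse of the product of the first n ideals (e i), expressed locally. *)
Definition inv_prefix (n : nat) : set K :=
  [set w | forall m, t_maximal D m -> localization D m w \/
    exists i, [/\ (i < n)%N, [set` e i] `<=` m &
      forall b, b \in e i -> localization D m (w * b)]].

(** The factor [x], common to all lists [e i], makes the ascending union of inverses integral. *)
Definition inv_union : set K := [set y | exists n, inv_prefix n (y / x)].

Lemma inv_prefix_le n n' : (n <= n')%N -> inv_prefix n `<=` inv_prefix n'.
Proof.
move=> nn' w hw m mm; have [|[i [ni im iw]]] := hw m mm; first by left.
by right; exists i; split=> //; exact: leq_trans nn'.
Qed.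

(** Disjointness forces any index supplied by [inv_prefix] to be [i]. *)
Lemma inv_prefix_mul n m i w b : t_maximal D m -> [set` e i] `<=` m ->
  inv_prefix n w -> b \in e i -> localization D m (w * b).
Proof.
move=> mm im hw bi; have [lw|[j [_ jm jw]]] := hw m mm.
  have [[_ _ lM] _] := loc_subsemiring Dring mm; apply: lM => //.
  by apply: sub_loc => //; exact: eD bi.
by apply: jw; rewrite (e_disjoint mm jm im).
Qed.

Lemma inv_prefix_out n m w : t_maximal D m ->
  (forall i, (i < n)%N -> ~ [set` e i] `<=` m) ->
  inv_prefix n w -> localization D m w.
Proof. by move=> mm nm /(_ m mm)[//|[i [/nm]]]. Qed.

Lemma inv_prefix_submodule n : submodule D (inv_prefix n).
Proof.
split.
- move=> m mm; left; apply: sub_loc => //.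
  by have [[]] := Dring.
- move=> a b ha hb m mm; have [[_ lD _] _] := loc_subsemiring Dring mm.
  have [[i [ni im]]|nm] := pselect (exists i, (i < n)%N /\ [set` e i] `<=` m).
    right; exists i; split=> // c ci; rewrite mulrDl.
    by apply: lD; [exact: (inv_prefix_mul mm im ha)|exact: (inv_prefix_mul mm im hb)].
  have out i : (i < n)%N -> ~ [set` e i] `<=` m by move=> ni im; apply: nm; exists i.
  by left; apply: lD; [exact: inv_prefix_out ha|exact: inv_prefix_out hb].
- move=> a w Da hw m mm; have [[_ _ lM] _] := loc_subsemiring Dring mm.
  have la := sub_loc Dring mm Da.
  have [lw|[i [ni im iw]]] := hw m mm; [left|right].
    exact: lM.
  by exists i; split=> // b /iw; rewrite -mulrA; exact: lM.
Qed.

Lemma inv_prefix_integral n w : inv_prefix n w -> D (x * w).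
Proof.
move=> hw; apply: (bigcap_loc Dring Dfrac) => m mm.
have [lw|[i [_ im iw]]] := hw m mm; last by rewrite mulrC; exact: iw.
have [[_ _ lM] _] := loc_subsemiring Dring mm; apply: lM => //.
exact: sub_loc.
Qed.

(** Each local condition puts a multiple c z in a localization, and a common denominator passes this
    from the list [s] to its v-closure. *)
Lemma inv_prefix_vlist n (s : seq K) :
  [set` s] `<=` inv_prefix n -> vlist D s `<=` inv_prefix n.
Proof.
move=> sW z sz m mm.
have vlist_loc c : (forall y, y \in s -> localization D m (c * y)) ->
    localization D m (c * z).
  move=> h; have [|y /h|t [Dt mt tc]] :=
    @common_denominator _ _ Dring m mm K ( *%R c) D s.
  - exact: DM.
  - by move=> /(locP mm).
  - apply/(locP mm); exists t; split=> //; rewrite mulrA; apply: sz => y ys.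
    by rewrite -mulrA; exact: tc.
have [[i [ni im]]|nm] := pselect (exists i, (i < n)%N /\ [set` e i] `<=` m).
  right; exists i; split=> // b bi; rewrite mulrC; apply: vlist_loc => y ys.
  by rewrite mulrC; apply: (inv_prefix_mul mm im _ bi); exact: sW.
left; rewrite -[z]mul1r; apply: vlist_loc => y ys; rewrite mul1r.
by apply: (inv_prefix_out mm _ (sW y ys)) => i ni im; apply: nm; exists i.
Qed.

Lemma inv_union_x : inv_union x.
Proof.
exists 0%N => m mm; left; rewrite divff //.
by apply: sub_loc => //; have [] := Dring.
Qed.

Lemma inv_union_mul n w : inv_prefix n w -> inv_union (x * w).
Proof. by move=> hw; exists n; rewrite mulrAC divff // mul1r. Qed.

Lemma inv_union_seq (s : seq K) : [set` s] `<=` inv_union ->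
  exists n, forall y, y \in s -> inv_prefix n (y / x).
Proof.
elim: s => [_|y s IH /set_cons_sub[[n ny] /IH[n' n's]]]; first by exists 0%N.
exists (maxn n n') => z; rewrite inE => /predU1P[->|/n's].
  by apply: inv_prefix_le ny; exact: leq_maxl.
by apply: inv_prefix_le; exact: leq_maxr.
Qed.

Lemma inv_union_t_ideal : t_ideal D inv_union.
Proof.
apply/(t_idealP Dring); split.
- split; last first.
    by move=> y [n /inv_prefix_integral]; rewrite mulrC divfK.
  split.
  + by exists 0%N; rewrite mul0r; have [] := inv_prefix_submodule 0.
  + move=> a b [n na] [n' nb]; exists (maxn n n'); rewrite mulrDl.
    have [_ wD _] := inv_prefix_submodule (maxn n n'); apply: wD.
      by apply: inv_prefix_le na; exact: leq_maxl.
    by apply: inv_prefix_le nb; exact: leq_maxr.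
  + move=> a b Da [n nb]; exists n; rewrite -mulrA.
    by have [_ _ wM] := inv_prefix_submodule n; exact: wM.
- by exists x => //; exact: inv_union_x.
- move=> s /inv_union_seq[n sn] z sz; exists n.
  rewrite mulrC; apply: (inv_prefix_vlist _ (vlist_scale (w := x^-1) sz)).
  by apply/set_map_sub => y /sn; rewrite mulrC.
Qed.

Lemma t_invertible_principal (m I : set K) b : t_maximal D m -> ideal D I ->
    I b -> b != 0 -> (forall y, I y -> localization D m (b^-1 * y)) ->
  t_invertible (localization D m) (extension D m I).
Proof.
move=> mm Iid Ib b0 hb; have [Imod _] := Iid.
have I0 : nonzero I by exists b.
apply/(t_invertibleP (loc_subsemiring Dring mm) (extension_ideal Dring mm Iid)
  (extension_nonzero Dring mm I0)).
exists [:: 1]; last by apply: vlist_mem; rewrite /= inE.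
apply/set_cons_sub; split=> //; rewrite -(divff b0); apply: prod_ideal_mul.
  exact: sub_extension.
exact/inv_extension.
Qed.

(** The PvMD property gives w with w e_k in [D]. At a t-maximal n not containing [e k] some entry is
    a unit, so w is local there; [k.+1] is the first level admitting the index [k]. *)
Lemma locally_principal_e m k : t_maximal D m -> [set` e k] `<=` m ->
  exists a w, [/\ a \in e k, inv_prefix k.+1 w, D (a * w) & ~ m (a * w)].
Proof.
move=> mm km; have [a [w [ak kw maw]]] :=
  PvMD_locally_principal Dring pvmd mm (@eD k) (ex k) x0.
exists a, w; split=> //; last by rewrite mulrC; exact: kw.
move=> n nm; have [kn|kn] := pselect ([set` e k] `<=` n).
  by right; exists k; split=> // b bk; apply: sub_loc => //; exact: kw.
left; have [c ck nc] : exists2 c, c \in e k & ~ n c.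
  apply: contrapT => h; apply: kn => c ck; apply: contrapT => nc.
  by apply: h; exists c.
by apply: (loc_divide nm (eD ck) nc); exact: kw.
Qed.

Lemma inv_union_t_locally_t_invertible : t_locally_t_invertible D inv_union.
Proof.
move=> m mm; have [Uid _ _] := inv_union_t_ideal.
(* If no [e k] lies in [m], every level is trivial at [m] and [x] generates locally; otherwise
   [x * w] does. *)
have [[k km]|nk] := pselect (exists k, [set` e k] `<=` m); last first.
  apply: (t_invertible_principal mm Uid inv_union_x x0) => y [n ny].
  rewrite mulrC; apply: (inv_prefix_out mm _ ny) => i _ im.
  by apply: nk; exists i.
have [a [w [ak kw Daw maw]]] := locally_principal_e mm km.
have := notin_tmax_neq0 mm maw; rewrite mulf_eq0 negb_or => /andP[a0 w0].
apply: (t_invertible_principal mm Uid (inv_union_mul kw)).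
  by rewrite mulf_neq0.
move=> y [n ny].
have -> : (x * w)^-1 * y = (a * w)^-1 * (y / x * a).
  by rewrite !invfM (mulrC _ a) mulrA (mulrAC a^-1) mulVf // mul1r mulrC mulrA mulrC.
have [[_ _ lM] _] := loc_subsemiring Dring mm; apply: lM; first exact: loc_inv.
exact: (inv_prefix_mul mm km ny).
Qed.

Lemma inv_union_not_t_invertible : ~ t_invertible D inv_union.
Proof.
have [Uid U0 _] := inv_union_t_ideal.
move=> /(t_invertibleP Dring Uid U0)[s sP s1].
(* The product of [inv_union] with its inverse is shown to lie in [P], the elements that eventually
   belong to every t-maximal ideal over [e N]. *)
pose P := [set y | exists N0, forall N m, (N0 <= N)%N -> t_maximal D m ->
  [set` e N] `<=` m -> m y].
have {}sP : [set` s] `<=` P.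
  apply: subset_trans sP _; apply: prod_ideal_sub.
  - by exists 0%N => N m _ mm _; exact: (tmax0 mm).
  - move=> y z [N0 hy] [N1 hz]; exists (maxn N0 N1) => N m.
    rewrite geq_max => /andP[N0N N1N] mm Nm.
    have [_ mD _] := tmax_submodule mm.
    by apply: mD; [exact: hy Nm|exact: hz Nm].
  - move=> j v [n nj] Uv; exists n => N m nN mm Nm.
    (* For N at least n, j / x is local at [m] while x w, of level N + 1, is still in the union.
       Regrouping makes a, which is in [m], a factor of a multiple of j v by an element outside
       [m]. *)
    have [a [w [aN Nw Daw maw]]] := locally_principal_e mm Nm.
    have Dvxw := Uv _ (inv_union_mul Nw).
    have /(locP mm)[t [Dt mt Dtj]] : localization D m (j / x).
      apply: (inv_prefix_out mm _ nj) => i ni im.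
      by move: ni; rewrite (e_disjoint mm im Nm) ltnNge nN.
    have Djv : D (j * v) by rewrite mulrC; apply: Uv; exists n.
    have mtaw := tmax_notin_mul Dring mm Dt mt Daw maw.
    have [|/mtaw//|//] := tmax_prime Dring mm (DM Dt Daw) Djv.
    have -> : t * (a * w) * (j * v) = (t * (j / x)) * (v * (x * w)) * a.
      have -> : j * v = j / x * (v * x) by rewrite mulrA mulrAC divfK.
      by rewrite mulrACA -[RHS]mulrA (mulrC (a * w)) (mulrC a) -!mulrA.
    by apply: (tmax_mul mm); [exact: DM|exact: Nm].
have [N0 hN0] : exists N0, forall N m, (N0 <= N)%N -> t_maximal D m ->
    [set` e N] `<=` m -> [set` s] `<=` m.
  elim: s {s1} sP => [_|y s IH /set_cons_sub[[N0 hy] /IH[N1 hs]]]; first by exists 0%N.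
  exists (maxn N0 N1) => N m; rewrite geq_max => /andP[N0N N1N] mm Nm.
  by apply/set_cons_sub; split; [exact: hy Nm|exact: hs Nm].
(* Some t-maximal ideal lies over [e N0]; it contains all of [s], hence 1. *)
have [m mm Nm] := e_proper N0.
exact/(tmax1 mm)/(tmax_vlist Dring mm (hN0 _ _ (leqnn N0) mm Nm) s1).
Qed.

End BazzoniFiniteCharacter.

Lemma bazzoni_t_finite_character (K : fieldType) (D : set K) :
    subsemiring D -> (forall x : K, exists s, [/\ D s, s != 0 & D (s * x)]) ->
    PvMD D ->
    (forall I, t_ideal D I -> t_locally_t_invertible D I -> t_invertible D I) ->
  t_finite_character D.
Proof.
move=> Dring Dfrac pvmd baz x Dx x0; apply: contrapT => inf.
have [e [eD ex e_proper e_disjoint]] := disjoint_lists Dring Dx inf.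
apply: (inv_union_not_t_invertible Dring Dfrac pvmd Dx x0 eD ex e_proper e_disjoint).
apply: baz; first exact: inv_union_t_ideal.
exact: inv_union_t_locally_t_invertible.
Qed.

(** * The domain inside its quotient field, and the equivalence *)

Lemma dom_subsemiring (A : idomainType) : subsemiring (dom A).
Proof.
split; last by exists 1 => //; exact: tofrac1.
split.
- by exists 0 => //; exact: tofrac0.
- by move=> _ _ [a _ <-] [b _ <-]; exists (a + b) => //; exact: tofracD.
- by move=> _ _ [a _ <-] [b _ <-]; exists (a * b) => //; exact: tofracM.
Qed.

(** The denominator of a ratio representing [x] clears it; the equation is checked on
    representatives. *)
Lemma dom_fraction (A : idomainType) (x : {fraction A}) :
  exists s, [/\ dom A s, s != 0 & dom A (s * x)].
Proof.
pose r := repr x; exists (FracField.tofrac ((frac r).2)); split.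
- by exists (frac r).2.
- by rewrite tofrac_eq0 denom_ratioP.
- exists (frac r).1 => //; rewrite -[x]reprK -/r; unlock FracField.tofrac.
  rewrite -[RHS]FracField.pi_mul; apply/eqmodP.
  rewrite /= FracField.equivfE /FracField.mulf !numden_Ratio;
    by rewrite ?mul1r ?oner_neq0 ?denom_ratioP ?(mulrC \d_r).
Qed.

Theorem proposition2p8 (A : idomainType) :
  t_locally_PvMD (dom A) ->
  [<-> (forall I : set {fraction A},
          t_ideal (dom A) I -> t_locally_t_invertible (dom A) I ->
          t_invertible (dom A) I);
       t_finite_character (dom A);
       PvMD (dom A) /\ t_finite_character (dom A)].
Proof.
move=> lPvMD; have Dring := dom_subsemiring A; have Dfrac := @dom_fraction A.
split; last split.
- move=> baz; apply: bazzoni_t_finite_character => //; exact: bazzoni_PvMD.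
- by move=> fin; split=> //; exact: t_finite_character_PvMD.
- by move=> [pvmd fin] I; exact: PvMD_t_finite_character_t_invertible.
Qed.
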